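(* If $G$ is an optimal digraph, then $\beta_G \leq \alpha_G$. Furthermore, either $\alpha_G = \beta_G$ or $\alpha_G = \beta_G + 1$.
   Context: Digraphs are finite, loopless, with at most one edge $uv$ per ordered pair. A digraph is $2$-free if no distinct $u,v$ have both $uv,vu$ as edges. A circular interval digraph is a digraph together with a fixed arrangement of its vertices in a circle such that for all distinct $u,v,w$ in clockwise order with $uw\in E(G)$, also $uv,vw\in E(G)$. For distinct $u,v$, $d(u,v) = 1 + |\{w: u,w,v \text{ distinct, in clockwise order}\}|$; this is the length of the ordered pair $uv$. A non-edge is an ordered pair $(u,v)$ of distinct vertices with neither $uv$ nor $vu$ an edge; its length is $d(u,v)$. $\alpha_G$ is the minimum length of a non-edge ($\infty$ if none) and $\beta_G$ the maximum length of an edge ($0$ if none). $\xi(G)$ is the number of pairs $(uv,(w,x))$ with $uv\in E(G)$, $(w,x)$ a non-edge, $d(u,v)>d(w,x)$. $\tilde P_3(G)$ is the number of triples $(a,b,c)$ of distinct vertices with $ab,bc\in E(G)$ and $ac,ca\notin E(G)$. For fixed $n\ge 4$, $G$ is optimal if it is a $2$-free circular interval digraph on $n$ vertices maximizing $\tilde P_3$ among all such digraphs and, subject to this, minimizing $\xi(G)$. *)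

(* Defs.v *)
From mathcomp Require Import all_boot.
Set Implicit Arguments. Unset Strict Implicit. Unset Printing Implicit Defensive.

(* A digraph on n vertices: vertex set 'I_n, edge relation E (E u v = uv is an edge).
   The fixed circular arrangement is the cyclic order 0,1,...,n-1 (clockwise). *)

(* d u v = 1 + #{w : u,w,v distinct, clockwise}  = (v - u) mod n for u <> v. *)
Definition dist n (u v : 'I_n) : nat := (v + n - u) %% n.

Definition cw n (u v w : 'I_n) : bool :=
  [&& u != v, v != w, u != w & dist u v < dist u w].

Definition loopless n (E : rel 'I_n) : Prop := forall u, ~~ E u u.

Definition two_free n (E : rel 'I_n) : Prop :=
  forall u v, u != v -> ~~ (E u v && E v u).

Definition circ_interval n (E : rel 'I_n) : Prop :=
  forall u v w, cw u v w -> E u w -> E u v && E v w.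

Definition valid n (E : rel 'I_n) : Prop :=
  [/\ loopless E, two_free E & circ_interval E].

Definition nonedge n (E : rel 'I_n) (u v : 'I_n) : bool :=
  [&& u != v, ~~ E u v & ~~ E v u].

(* alpha_G : minimum length of a non-edge; None encodes infinity *)
Definition alphaG n (E : rel 'I_n) : option nat :=
  if [exists p : 'I_n * 'I_n, nonedge E p.1 p.2]
  then Some (\big[minn/n]_(p : 'I_n * 'I_n | nonedge E p.1 p.2) dist p.1 p.2)
  else None.

Definition betaG n (E : rel 'I_n) : nat :=
  \max_(p : 'I_n * 'I_n | E p.1 p.2) dist p.1 p.2.

Definition xi n (E : rel 'I_n) : nat :=
  #|[set q : ('I_n * 'I_n) * ('I_n * 'I_n) |
      [&& E q.1.1 q.1.2, nonedge E q.2.1 q.2.2 &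
          dist q.2.1 q.2.2 < dist q.1.1 q.1.2]]|.

Definition P3t n (E : rel 'I_n) : nat :=
  #|[set t : 'I_n * 'I_n * 'I_n |
      [&& t.1.1 != t.1.2, t.1.2 != t.2, t.1.1 != t.2,
          E t.1.1 t.1.2, E t.1.2 t.2, ~~ E t.1.1 t.2 & ~~ E t.2 t.1.1]]|.

Definition optimal n (E : rel 'I_n) : Prop :=
  [/\ valid E,
      (forall H : rel 'I_n, valid H -> P3t H <= P3t E) &
      (forall H : rel 'I_n, valid H -> P3t H = P3t E -> xi E <= xi H)].

(* Main.v *)
Require Import Defs.
From mathcomp Require Import all_boot zify.
Set Implicit Arguments. Unset Strict Implicit. Unset Printing Implicit Defensive.

(** Adding to a circular interval digraph a pair (u, v) of length l, so that it
    stays 2-free circular interval, changes the number of induced two-edge paths by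
      g(u, v) = s - (l - 1) - 3 t,   s = outdeg v + indeg u,   t = #{c | v -> c -> u},
    where t = max(0, s - (n - 1 - l)).  Suppose a = alpha < b = beta.  Deleting a
    longest edge, or adding a shortest non-edge, strictly decreases xi, so by
    optimality each such move strictly decreases the number of induced paths; all
    degrees lie in [a - 1, b], and one gets |N| <= 1 for N = 3n - 4(a + b).
    Let X be the set of all edges of length b and Y the set of all non-edges of
    length a.  Moves within X do not interact, nor do those within Y.  Let I count
    the incidences of X with Y (the end of one pair is the start of the other).
    Deleting X and then adding Y changes the number of induced paths by at least
      (N + 2)|Y| + (2 - N)|X| - 2 I >= 0,
    because I <= 2|X| and I <= 2|Y|; but it strictly decreases xi. *)

(** * Circular distance, clockwise order and the sizes of arcs *)

Section Circle.
Variable n : nat.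
Implicit Types u v w x a b c : 'I_n.

Lemma distE u v : dist u v = if u <= v then v - u else v + n - u.
Proof.
rewrite /dist; case: leqP => h.
  rewrite -addnBAC // modnDr modn_small //.
  by have := ltn_ord v; lia.
by rewrite modn_small //; have := ltn_ord u; lia.
Qed.

Lemma neq_ord_val u v : (u != v) = (nat_of_ord u != nat_of_ord v).
Proof. by []. Qed.

Lemma dist_lt u v : dist u v < n.
Proof. by rewrite distE; have ? := ltn_ord u; have ? := ltn_ord v; case: ifP => ?; lia. Qed.

Lemma dist_gt0 u v : (0 < dist u v) = (u != v).
Proof.
rewrite distE neq_ord_val; have ? := ltn_ord u; have ? := ltn_ord v.
by do !case: ifP => ?; lia.
Qed.

Lemma dist_sym u v : u != v -> dist u v + dist v u = n.
Proof.
rewrite neq_ord_val !distE; have ? := ltn_ord u; have ? := ltn_ord v.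
by do !case: ifP => ?; lia.
Qed.

Lemma dist_injr u : injective (dist u).
Proof.
move=> v w; rewrite !distE => h; apply: val_inj => /=; move: h.
have ? := ltn_ord u; have ? := ltn_ord v; have ? := ltn_ord w.
by do !case: ifP => ?; lia.
Qed.

Lemma dist_injl v : injective (fun u => dist u v).
Proof.
move=> u w; rewrite !distE => h; apply: val_inj => /=; move: h.
have ? := ltn_ord u; have ? := ltn_ord v; have ? := ltn_ord w.
by do !case: ifP => ?; lia.
Qed.

Lemma cwE u v w : cw u v w = (0 < dist u v < dist u w).
Proof.
rewrite /cw -!dist_gt0; apply/and4P/andP => [[? ? ? ?]|[h1 h2]]; first by [].
have vw : v != w by apply: contraTneq h2 => ->; rewrite ltnn.
by rewrite h1 h2 (ltn_trans h1 h2) dist_gt0 vw.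
Qed.

Lemma cw_rot u v w : cw u v w = cw v w u.
Proof.
rewrite !cwE !distE; have ? := ltn_ord u; have ? := ltn_ord v; have ? := ltn_ord w.
by do !case: ifP => ?; lia.
Qed.

Lemma cw_dist u v w : cw u v w -> dist u v + dist v w = dist u w.
Proof.
rewrite !cwE !distE; have ? := ltn_ord u; have ? := ltn_ord v; have ? := ltn_ord w.
by do !case: ifP => ?; lia.
Qed.

Lemma cwEl u v w : cw u v w = (0 < dist v w < dist u w).
Proof.
rewrite !cwE !distE; have ? := ltn_ord u; have ? := ltn_ord v; have ? := ltn_ord w.
by do !case: ifP => ?; lia.
Qed.

Lemma cw_or u v w : u != v -> v != w -> u != w -> cw u v w || cw u w v.
Proof.
rewrite !cwE !neq_ord_val !distE; have ? := ltn_ord u; have ? := ltn_ord v; have ? := ltn_ord w.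
by do !case: ifP => ?; lia.
Qed.

Lemma card_ord_interval k : k < n -> #|[set z : 'I_n | 0 < z <= k]| = k.
Proof.
case: n => // m; rewrite ltnS => kn.
have e : [set z : 'I_m.+1 | 0 < z <= k] = [set inord i.+1 | i : 'I_k].
  apply/setP => z; rewrite inE; apply/idP/imsetP.
    case/andP => z0 zk.
    have h : z.-1 < k by lia.
    exists (Ordinal h) => //; apply: val_inj => /=; rewrite inordK; lia.
  case=> i _ ->; have := ltn_ord i => ik; rewrite inordK; lia.
rewrite e card_imset ?card_ord // => i j /(congr1 val) /=.
have := ltn_ord i; have := ltn_ord j => ? ?.
rewrite !inordK; [|lia|lia] => h; apply: val_inj => /=; lia.
Qed.

(** Being injective with values below [n], [f] is a bijection onto ['I_n], so the count is that of
    an interval. It serves [dist] in either argument. *)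
Lemma card_dist_pos (f : 'I_n -> nat) k : injective f -> (forall y, f y < n) ->
  k < n -> #|[set y | 0 < f y <= k]| = k.
Proof.
move=> fi fn kn; rewrite -[RHS]card_ord_interval //.
have gi : injective (fun y => Ordinal (fn y)) by move=> y z [] /fi.
rewrite -(card_imset _ gi); apply: eq_card => z; rewrite !inE.
apply/imsetP/idP => [[y] | h]; first by rewrite inE => ? ->.
have [g _ gK] := injF_bij gi.
by exists (g z); rewrite ?gK // inE; have := congr1 val (gK z) => /= ->.
Qed.

Lemma card_ball_out u k : k < n -> #|[set y | 0 < dist u y <= k]| = k.
Proof. by apply: card_dist_pos; [exact: dist_injr | exact: dist_lt]. Qed.

Lemma card_ball_in u k : k < n -> #|[set y | 0 < dist y u <= k]| = k.
Proof. by apply: (@card_dist_pos (fun y => dist y u)) => [|y]; [exact: dist_injl | exact: dist_lt]. Qed.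

Lemma card_cw u v : u != v -> #|[set b | cw u b v]| = (dist u v).-1.
Proof.
rewrite -dist_gt0 => uv; have := dist_lt u v => l.
rewrite -(@card_ball_out u (dist u v).-1); last lia.
by apply: eq_card => b; rewrite !inE cwE; lia.
Qed.

End Circle.

(** * The effect of one added edge on the number of induced two-edge paths *)

Section Toggle.
Variable n : nat.
Implicit Types (E F : rel 'I_n) (u v w x a b c : 'I_n) (S : {set 'I_n * 'I_n}).

Definition outs F v := [set c | F v c].
Definition ins F u := [set a | F a u].

Definition tri F u v := #|outs F v :&: ins F u|.

Lemma valid_neq F u v : valid F -> F u v -> u != v.
Proof. by case=> l _ _; apply: contraTneq => ->. Qed.

Lemma valid_asym F u v : valid F -> F u v -> ~~ F v u.
Proof.
move=> vF uv; case: (vF) => _ t _.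
by have := t _ _ (valid_neq vF uv); rewrite uv.
Qed.

(** If [c] lay beyond [u], then [u] would be inside the arc of the edge [vc], and the interval
    property would make [vu] an edge. *)
Lemma outs_cw F u v c : valid F -> u != v -> ~~ F v u -> F v c -> cw v c u.
Proof.
move=> vF uv nvu vc; have cu : c != u by apply: contraNneq nvu => <-.
have /orP[//|h] := cw_or (valid_neq vF vc) cu (contra_neq (@esym _ _ _) uv).
by case: vF => _ _ ci; case/andP: (ci _ _ _ h vc) => h' _; rewrite h' in nvu.
Qed.

Lemma ins_cw F u v c : valid F -> u != v -> ~~ F v u -> F c u -> cw v c u.
Proof.
move=> vF uv nvu cu; have cv : v != c by apply: contraNneq nvu => ->.
have /orP[//|h] := cw_or cv (valid_neq vF cu) (contra_neq (@esym _ _ _) uv).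
case: vF => _ _ ci; rewrite cw_rot cw_rot in h.
by case/andP: (ci _ _ _ h cu) => _ h'; rewrite h' in nvu.
Qed.

(** Inclusion-exclusion: both sets lie in the open arc from [v] to [u]. *)
Lemma tri_lower F u v : valid F -> u != v -> ~~ F v u ->
  #|outs F v| + #|ins F u| <= tri F u v + (dist v u).-1.
Proof.
move=> vF uv nvu; rewrite -card_cw 1?eq_sym // -cardsUI addnC leq_add2l.
apply: subset_leq_card; apply/subsetP => c; rewrite !inE.
by case/orP; [exact: outs_cw | exact: ins_cw].
Qed.

(** A common vertex [c] makes the two sets cover the arc from [v] to [u]: a vertex before [c] is an
    out-neighbour of [v], one after [c] an in-neighbour of [u]. *)
Lemma tri_upper F u v : valid F -> u != v -> ~~ F v u -> 0 < tri F u v ->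
  tri F u v + (dist v u).-1 <= #|outs F v| + #|ins F u|.
Proof.
move=> vF uv nvu; case/card_gt0P => c; rewrite !inE => /andP[vc cu].
rewrite -card_cw 1?eq_sym // -cardsUI addnC leq_add2r.
apply: subset_leq_card; apply/subsetP => b; rewrite !inE => h.
have := outs_cw vF uv nvu vc; case: (vF) => _ _ ci.
have [-> | bc] := eqVneq b c; first by rewrite vc.
move=> h'; move: (h) (h'); rewrite !cwE => /andP[h1 h2] /andP[h3 h4].
case: (ltngtP (dist v b) (dist v c)) => [l|l|/dist_injr e]; last by rewrite e eqxx in bc.
  by have /andP[->] := ci v b c (ltac:(by rewrite cwE h1)) vc.
have cwc : cw c b u.
  have := cw_dist h; have := cw_dist h'.
  by move: h h'; rewrite !cwEl; lia.
by have /andP[_ ->] := ci c b u cwc cu; rewrite orbT.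
Qed.

Lemma P3t_sum E : P3t E = \sum_(t : 'I_n * 'I_n * 'I_n)
      [&& t.1.1 != t.1.2, t.1.2 != t.2, t.1.1 != t.2,
          E t.1.1 t.1.2, E t.1.2 t.2, ~~ E t.1.1 t.2 & ~~ E t.2 t.1.1].
Proof. by rewrite /P3t cardsE -sum1_card big_mkcond; apply: eq_bigr => t _; rewrite unfold_in; case: ifP. Qed.

Lemma sum_nat_image (T U : finType) (f : U -> T) (Q : pred U) (P : pred T) :
  injective f -> (forall t, reflect (exists2 y, Q y & t = f y) (P t)) ->
  \sum_(t : T) (P t : nat) = #|[set y | Q y]|.
Proof.
move=> fi h; rewrite -(card_imset _ fi) -sum1_card [RHS]big_mkcond /=.
apply: eq_bigr => t _.
have -> : (t \in [set f y | y in [set y | Q y]]) = P t.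
  by apply/imsetP/h => -[y]; rewrite ?inE => Qy ->; exists y; rewrite ?inE.
by case: (P t).
Qed.

(** The edge [uv] destroys the paths from [u] to [v] and the [tri F u v] paths from [v] to [u]. It
    creates paths through [outs F v] minus [ins F u] and through [ins F u] minus [outs F v], which
    loses [tri F u v] twice more; hence the factor 3. *)
Lemma P3t_add1 F F' u v : valid F -> valid F' -> ~~ F u v ->
  (forall a b, F' a b = F a b || ((a, b) == (u, v))) ->
  P3t F' + (dist u v).-1 + 3 * tri F u v = P3t F + #|outs F v| + #|ins F u|.
Proof.
move=> vF vF' nuv F'E.
have F'uv : F' u v by rewrite F'E eqxx orbT.
have uv := valid_neq vF' F'uv.
have nvu : ~~ F v u.
  by have := valid_asym vF' F'uv; rewrite F'E negb_or => /andP[].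
have Fo c : F v c -> ~~ F u c.
  move=> vc; have := outs_cw vF uv nvu vc; rewrite cw_rot cw_rot => h.
  apply: contra nuv => uc; case: (vF) => _ _ ci.
  have cuv : cw u v c by [].
  by case/andP: (ci _ _ _ cuv uc).
have Fi c : F c u -> ~~ F c v.
  move=> cu; have := ins_cw vF uv nvu cu; rewrite cw_rot => h.
  apply: contra nuv => uc; case: (vF) => _ _ ci.
  by case/andP: (ci _ _ _ h uc).
(* The balance holds triple by triple: new paths plus the two kinds of destroyed path equal old
   paths plus the two kinds of created path. The cases say which of [ab], [bc], [ac], [ca] is the
   added pair. *)
have key a b c : [&& a != b, b != c, a != c, F' a b, F' b c, ~~ F' a c & ~~ F' c a]
   + [&& a == u, c == v, F u b & F b v] + [&& a == v, c == u, F v b & F b u]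
  = [&& a != b, b != c, a != c, F a b, F b c, ~~ F a c & ~~ F c a]
   + [&& a == u, b == v, F v c & ~~ F c u] + [&& b == u, c == v, F a u & ~~ F v a].
  rewrite !F'E !xpair_eqE.
  have luu : F u u = false by apply/negbTE; case: (vF).
  have lvv : F v v = false by apply/negbTE; case: (vF).
  move: (uv) (nuv) (nvu) => /negbTE uv' /negbTE nuv' /negbTE nvu'.
  have vu' : (v == u) = false by rewrite eq_sym.
  have simp := (eqxx, uv', vu', luu, lvv, nuv', nvu', andbF, andbT, orbF, andFb, addn0, add0n).
  have [/andP[/eqP -> /eqP ->]|] := boolP ((a == u) && (b == v)).
    rewrite ?simp /=.
    case vc : (F v c); rewrite ?simp //=.
    have vc' := valid_neq vF vc; rewrite vc' (negbTE (Fo _ vc)) ![c == v]eq_sym (negbTE vc') ?simp.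
    case: (eqVneq u c) => [e|] //=.
    by move: vc; rewrite -e nvu'.
  move=> ab; have [/andP[/eqP -> /eqP ->]|bc] := boolP ((b == u) && (c == v)).
    rewrite ?simp /=.
    case au : (F a u); rewrite ?simp //=.
    have au' := valid_neq vF au; rewrite au' (negbTE (Fi _ au)) (negbTE au') ?simp.
    case: (eqVneq a v) => [e|] //=.
    by move: au; rewrite e nvu'.
  have [/andP[/eqP -> /eqP ->]|ac] := boolP ((a == u) && (c == v)).
    rewrite ?simp /= ?simp.
    case ub : (F u b); case bv : (F b v); rewrite ?simp //=.
    by rewrite (valid_neq vF ub) (valid_neq vF bv).
  have [/andP[/eqP -> /eqP ->]|ca] := boolP ((a == v) && (c == u)).
    rewrite ?simp /= ?simp.
    case vb : (F v b); case bu : (F b u); rewrite ?simp //=.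
    by rewrite (valid_neq vF vb) (valid_neq vF bu).
  move: ab bc ac ca => /negbTE ab /negbTE bc /negbTE ac /negbTE ca.
  by rewrite !andbA ab bc ac ca [(c == u) && _]andbC ca ?simp.
have := @eq_bigr _ 0 addn _ (index_enum _) xpredT _ _ (fun t _ => key t.1.1 t.1.2 t.2).
rewrite !big_split /= -!P3t_sum.
(* Every vertex inside the arc is a midpoint because [F'] has the interval property; no other is,
   since [uv] is not an edge of [F]. *)
have -> : \sum_(i : 'I_n * 'I_n * 'I_n) [&& i.1.1 == u, i.2 == v, F u i.1.2 & F i.1.2 v] = (dist u v).-1.
  rewrite (@sum_nat_image _ _ (fun b => (u, b, v)) (fun b => F u b && F b v)).
  - rewrite -card_cw //; apply: eq_card => b; rewrite !inE; apply/andP/idP => [[ub bv]|h].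
      case/orP: (cw_or (valid_neq vF ub) (valid_neq vF bv) uv) => // h.
      by case: vF => _ _ /(_ _ _ _ h ub) /andP[h1 _]; rewrite h1 in nuv.
    case: vF' => _ _ /(_ _ _ _ h F'uv) /andP[]; rewrite !F'E !xpair_eqE.
    move: h; case/and4P => /negbTE ub /negbTE bv _ _.
    by rewrite bv [b == u]eq_sym ub !andbF !orbF.
  - by move=> b c [].
  - move=> [[a b] c] /=; apply: (iffP and4P).
      by case=> /eqP -> /eqP -> h1 h2; exists b; rewrite ?h1 ?h2.
    by case=> y /andP[h1 h2] [-> -> ->]; rewrite !eqxx.
have -> : \sum_(i : 'I_n * 'I_n * 'I_n) [&& i.1.1 == v, i.2 == u, F v i.1.2 & F i.1.2 u] = tri F u v.
  rewrite (@sum_nat_image _ _ (fun b => (v, b, u)) (fun b => F v b && F b u)).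
  - by apply: eq_card => b; rewrite !inE.
  - by move=> b c [].
  - move=> [[a b] c] /=; apply: (iffP and4P).
      by case=> /eqP -> /eqP -> h1 h2; exists b; rewrite ?h1 ?h2.
    by case=> y /andP[h1 h2] [-> -> ->]; rewrite !eqxx.
have -> : \sum_(i : 'I_n * 'I_n * 'I_n) [&& i.1.1 == u, i.1.2 == v, F v i.2 & ~~ F i.2 u] = #|outs F v :\: ins F u|.
  rewrite (@sum_nat_image _ _ (fun b => (u, v, b)) (fun b => F v b && ~~ F b u)).
  - by apply: eq_card => b; rewrite !inE andbC.
  - by move=> b c [].
  - move=> [[a b] c] /=; apply: (iffP and4P).
      by case=> /eqP -> /eqP -> h1 h2; exists c; rewrite ?h1 ?h2.
    by case=> y /andP[h1 h2] [-> -> ->]; rewrite !eqxx.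
have -> : \sum_(i : 'I_n * 'I_n * 'I_n) [&& i.1.2 == u, i.2 == v, F i.1.1 u & ~~ F v i.1.1] = #|ins F u :\: outs F v|.
  rewrite (@sum_nat_image _ _ (fun b => (b, u, v)) (fun b => F b u && ~~ F v b)).
  - by apply: eq_card => b; rewrite !inE andbC.
  - by move=> b c [].
  - move=> [[a b] c] /=; apply: (iffP and4P).
      by case=> /eqP -> /eqP -> h1 h2; exists a; rewrite ?h1 ?h2.
    by case=> y /andP[h1 h2] [-> -> ->]; rewrite !eqxx.
have h1 := cardsID (ins F u) (outs F v).
have h2 := cardsID (outs F v) (ins F u).
rewrite setIC in h2.
by rewrite /tri -h1 -h2; lia.
Qed.

End Toggle.

(** * Adding and deleting sets of pairs, and the effect on [xi] *)

Section Exchange.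
Variable n : nat.
Implicit Types (E F H : rel 'I_n) (u v w x a b c : 'I_n) (S T : {set 'I_n * 'I_n}).

Definition addp F S : rel 'I_n := fun a b => F a b || ((a, b) \in S).
Definition delp F S : rel 'I_n := fun a b => F a b && ((a, b) \notin S).

Lemma P3t_ext E F : E =2 F -> P3t E = P3t F.
Proof. by move=> e; rewrite !P3t_sum; apply: eq_bigr => t _; rewrite !e. Qed.

(* No two pairs of S are consecutive: then adding some of them leaves the score
   out v + in u - 3 tri of the others unchanged. *)
Definition addable F S :=
  [/\ forall p, p \in S -> [/\ p.1 != p.2, ~~ F p.1 p.2 & ~~ F p.2 p.1],
      forall p q, p \in S -> q \in S -> p.2 != q.1
    & forall p v, p \in S -> cw p.1 v p.2 -> F p.1 v && F v p.2].

Lemma addable_sub F S T : T \subset S -> addable F S -> addable F T.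
Proof.
move=> /subsetP sTS [h1 h2 h3]; split=> [p /sTS|p q /sTS ? /sTS|p v /sTS]; first exact: h1.
  exact: h2.
exact: h3.
Qed.

Lemma valid_addp F S : valid F -> addable F S -> valid (addp F S).
Proof.
move=> vF [h1 h2 h3]; case: (vF) => l t ci; split.
- move=> u; rewrite /addp negb_or l; apply/negP => /h1 [] /=; by rewrite eqxx.
- move=> u v uv; rewrite /addp; apply/negP => /andP[/orP[uv1|uv1] /orP[vu1|vu1]].
  + by have := t _ _ uv; rewrite uv1 vu1.
  + by have [_ _ /=] := h1 _ vu1; rewrite uv1.
  + by have [_ _ /=] := h1 _ uv1; rewrite vu1.
  + by have := h2 _ _ uv1 vu1; rewrite /= eqxx.
- move=> u v w cuvw; rewrite /addp => /orP[uw|uw].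
    by case/andP: (ci _ _ _ cuvw uw) => -> ->.
  by case/andP: (h3 _ _ uw cuvw) => /= -> ->.
Qed.

(** Induction on the size of [S], adding one pair at a time: no pair of [S] starts at [p.2] or ends
    at [p.1], so the terms for [p] are the same in [F] as after the other additions. *)
Lemma P3t_addp F S : valid F -> addable F S ->
  P3t (addp F S) + \sum_(p in S) ((dist p.1 p.2).-1 + 3 * tri F p.1 p.2)
  = P3t F + \sum_(p in S) (#|outs F p.2| + #|ins F p.1|).
Proof.
move=> vF; move En : #|S| => m; elim: m S En => [|m IH] S Sm adS.
  have -> : S = set0 by apply/eqP; rewrite -cards_eq0 Sm.
  rewrite !big_set0 !addn0; apply: P3t_ext => a b; by rewrite /addp inE orbF.
have /card_gt0P[p pS] : 0 < #|S| by rewrite Sm.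
rewrite !(big_setD1 p pS) /=; set T := S :\ p.
have sTS : T \subset S by apply: subD1set.
have adT := addable_sub sTS adS.
have Tm : #|T| = m by move: Sm; rewrite (cardsD1 p) pS => -[].
have := IH _ Tm adT.
have [h1 h2 h3] := adS.
have oT : outs (addp F T) p.2 = outs F p.2.
  apply/setP => c; rewrite !inE /addp; case: (boolP (_ \in T)) => [|_]; last by rewrite orbF.
  by move/(subsetP sTS) => cS; have := h2 _ _ pS cS; rewrite /= eqxx.
have iT : ins (addp F T) p.1 = ins F p.1.
  apply/setP => c; rewrite !inE /addp; case: (boolP (_ \in T)) => [|_]; last by rewrite orbF.
  by move/(subsetP sTS) => cS; have := h2 _ _ cS pS; rewrite /= eqxx.
have := @P3t_add1 _ (addp F T) (addp F S) p.1 p.2 (valid_addp vF adT) (valid_addp vF adS).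
have -> : tri (addp F T) p.1 p.2 = tri F p.1 p.2 by rewrite /tri oT iT.
rewrite oT iT -surjective_pairing.
have -> : ~~ addp F T p.1 p.2.
  by rewrite /addp negb_or; have [_ -> _] := h1 _ pS; rewrite -surjective_pairing !inE eqxx.
move=> /(_ isT) htog.
have e a b : addp F S a b = addp F T a b || ((a, b) == p).
  by rewrite /addp !inE; case: eqP => [->|_]; rewrite /= ?pS ?orbT ?orbF.
move: (htog e) => {}htog.
set A := \sum_(_ in _) _; set B := \sum_(_ in _) _; by move=> hIH; move: htog => /=; lia.
Qed.

Lemma addable1 F S u v : u != v -> ~~ F u v -> ~~ F v u ->
  (forall x, cw u x v -> F u x && F x v) -> addable F [set (u, v)].
Proof.
move=> uv nuv nvu h; split=> [p|p q|p x].
- by rewrite inE => /eqP ->.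
- by rewrite !inE => /eqP -> /eqP ->; rewrite eq_sym.
- by rewrite inE => /eqP ->; exact: h.
Qed.

(** The interval property for a surviving edge asks only for strictly shorter pairs, and these are
    not deleted. *)
Lemma valid_del_longest E (b : nat) S : valid E ->
  (forall u v, E u v -> dist u v <= b) ->
  (forall p, p \in S -> dist p.1 p.2 = b) -> valid (delp E S).
Proof.
move=> [l t ci] hb hS; split.
- by move=> u; rewrite /delp (negbTE (l u)).
- move=> u v uv; rewrite /delp; apply: contra (t _ _ uv) => /andP[/andP[-> _] /andP[-> _]] //.
- move=> u v w c; rewrite /delp => /andP[uw _].
  have ub := hb _ _ uw; have [/= ? uvw] := (isT, cw_dist c).
  have := c; rewrite cwE => /andP[c1 c2]; have := c; rewrite cwEl => /andP[c3 c4].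
  case/andP: (ci _ _ _ c uw) => -> -> /=.
  by apply/andP; split; apply/negP => /hS /=; lia.
Qed.

(** Lets a deletion be evaluated by [P3t_addp], as the addition of [S] back to [delp E S]. *)
Lemma addable_del_longest E (b : nat) S : valid E ->
  (forall u v, E u v -> dist u v <= b) ->
  (forall p, p \in S -> E p.1 p.2 && (dist p.1 p.2 == b)) ->
  (forall p q, p \in S -> q \in S -> p.2 != q.1) -> addable (delp E S) S.
Proof.
move=> vE hb hS h2; split=> // [p pS|[u w] v pS /= c].
  have /andP[Ep _] := hS _ pS; rewrite (valid_neq vE Ep).
  by rewrite /delp (negbTE (valid_asym vE Ep)) -surjective_pairing pS andbF.
have /andP[/= Ep /eqP db] := hS _ pS; case: vE => _ _ ci.
have := c; rewrite cwE => /andP[c1 c2]; have := c; rewrite cwEl => /andP[c3 c4].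
case/andP: (ci _ _ _ c Ep) => h3 h4; rewrite /delp h3 h4 /=.
by apply/andP; split; apply/negP => /hS /andP[_ /eqP] /=; lia.
Qed.

Lemma addp_delp E S : (forall p, p \in S -> E p.1 p.2) -> addp (delp E S) S =2 E.
Proof.
move=> h u v; rewrite /addp /delp; case: (boolP (_ \in S)) => [/h|] /=.
  by rewrite orbT.
by rewrite andbT orbF.
Qed.

(** No pair is newly counted: a new edge has length [a], and no non-edge of [E] is shorter; a new
    non-edge has length [b] or [n - b], at least [b], and no edge is longer. The pair in the last
    hypothesis is lost. *)
Lemma xi_lt E H (a b : nat) : a < b -> b.*2 <= n ->
  (forall u v, E u v -> dist u v <= b) ->
  (forall u v, nonedge E u v -> a <= dist u v) ->
  (forall u v, H u v -> E u v || (dist u v == a)) ->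
  (forall u v, E u v -> H u v || (dist u v == b)) ->
  (exists u v, [/\ E u v, dist u v = b & exists w x, [/\ nonedge E w x, dist w x = a &
     ~~ H u v || H w x]]) ->
  xi H < xi E.
Proof.
move=> ab bn hb ha HE EH [u [v [uv duv [w [x [wx dwx hd]]]]]].
apply: proper_card; apply/properP; split.
  apply/subsetP => -[[p q] [r s]]; rewrite !inE /= => /and3P[pq rs lt].
  have rsE : nonedge E r s.
    case/and3P: rs => rs Hrs Hsr; have ds := dist_sym rs.
    have bpq : dist p q <= b by case/orP: (HE _ _ pq) => [/hb //|/eqP ->]; exact: ltnW.
    rewrite /nonedge rs /=; apply/andP; split; apply/negP => /EH.
      by rewrite (negbTE Hrs) /= => /eqP; lia.
    by rewrite (negbTE Hsr) /= => /eqP; lia.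
  rewrite rsE lt !andbT; case/orP: (HE _ _ pq) => // /eqP e.
  by have := ha _ _ rsE; lia.
exists ((u, v), (w, x)); rewrite !inE /= ?uv ?wx ?duv ?dwx ?ab //.
rewrite andbT; case/orP: hd => [/negbTE -> //|wxH].
by rewrite /nonedge wxH !andbF.
Qed.

End Exchange.

(** * Degree bounds from the lengths of edges and non-edges *)

Section Degrees.
Variable n : nat.
Implicit Types (E F H : rel 'I_n) (u v w x y z : 'I_n).

Lemma outs_le E x k : valid E -> k < n -> (forall y, E x y -> dist x y <= k) ->
  #|outs E x| <= k.
Proof.
move=> vE kn h; rewrite -[leqRHS](card_ball_out x kn).
apply/subset_leq_card/subsetP => y; rewrite !inE => xy.
by rewrite dist_gt0 (valid_neq vE xy) h.
Qed.

Lemma ins_le E x k : valid E -> k < n -> (forall y, E y x -> dist y x <= k) ->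
  #|ins E x| <= k.
Proof.
move=> vE kn h; rewrite -[leqRHS](card_ball_in x kn).
apply/subset_leq_card/subsetP => y; rewrite !inE => xy.
by rewrite dist_gt0 (valid_neq vE xy) h.
Qed.

Lemma outs_ge E x k : k < n -> (forall y, 0 < dist x y <= k -> E x y) ->
  k <= #|outs E x|.
Proof.
move=> kn h; rewrite -[leqLHS](card_ball_out x kn).
by apply/subset_leq_card/subsetP => y; rewrite !inE; exact: h.
Qed.

Lemma ins_ge E x k : k < n -> (forall y, 0 < dist y x <= k -> E y x) ->
  k <= #|ins E x|.
Proof.
move=> kn h; rewrite -[leqLHS](card_ball_in x kn).
by apply/subset_leq_card/subsetP => y; rewrite !inE; exact: h.
Qed.

Lemma outs_ge_edge E x z : valid E -> E x z -> dist x z <= #|outs E x|.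
Proof.
move=> [_ _ ci] xz; apply: outs_ge (dist_lt _ _) _ => y /andP[y0].
rewrite leq_eqVlt => /orP[/eqP/dist_injr -> //|yz].
by case/andP: (ci x y z (ltac:(by rewrite cwE y0)) xz).
Qed.

Lemma outs_lt_nonedge E x z : valid E -> x != z -> ~~ E x z -> #|outs E x| < dist x z.
Proof.
move=> vE xz nxz; have d0 : 0 < dist x z by rewrite dist_gt0.
suff : #|outs E x| <= (dist x z).-1 by lia.
apply: outs_le => // [|y xy]; first by have := dist_lt x z; lia.
suff : dist x y < dist x z by lia.
case: ltngtP => // [h|/dist_injr e]; last by rewrite -e xy in nxz.
case: vE => _ _ /(_ x z y); rewrite cwE d0 h => /(_ isT xy).
by rewrite (negbTE nxz).
Qed.

Lemma ins_lt_nonedge E x z : valid E -> z != x -> ~~ E z x -> #|ins E x| < dist z x.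
Proof.
move=> vE xz nxz; have d0 : 0 < dist z x by rewrite dist_gt0.
suff : #|ins E x| <= (dist z x).-1 by lia.
apply: ins_le => // [|y xy]; first by have := dist_lt z x; lia.
suff : dist y x < dist z x by lia.
case: ltngtP => // [h|/dist_injl e]; last by rewrite -e xy in nxz.
case: vE => _ _ /(_ y z x); rewrite cwEl d0 h => /(_ isT xy).
by rewrite (negbTE nxz) andbF.
Qed.

End Degrees.

(** * Excluding a non-edge shorter than the longest edge *)

Section Main.
Variable n : nat.
Implicit Types (E F H : rel 'I_n) (u v w x y z : 'I_n).

(** Pairs of one fixed length are determined by their ends, so mapping [p] to [p.2] injects the
    incident pairs into the starts of [Y]. *)
Lemma card_ends (X Y : {set 'I_n * 'I_n}) b :
  (forall p, p \in X -> dist p.1 p.2 = b) ->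
  \sum_(p in X) [exists q in Y, q.1 == p.2] <= #|Y|.
Proof.
move=> hX.
have -> : \sum_(p in X) [exists q in Y, q.1 == p.2] = #|[set p in X | [exists q in Y, q.1 == p.2]]|.
  rewrite -sum1_card [RHS]big_mkcond [LHS]big_mkcond; apply: eq_bigr => p _.
  by rewrite inE; case: (p \in X) => //=; case: [exists _, _].
rewrite -(card_in_imset (f := snd)).
  apply: leq_trans (leq_imset_card fst Y); apply/subset_leq_card/subsetP => z.
  case/imsetP => p; rewrite inE => /andP[_ /existsP[q /andP[qY /eqP e]]] ->.
  by apply/imsetP; exists q.
move=> [u v] [w x] /[!inE] /andP[/hX /= h1 _] /andP[/hX /= h2 _] e.
by move: h1; rewrite e -h2 => /dist_injl ->.
Qed.

Lemma card_starts (X Y : {set 'I_n * 'I_n}) b :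
  (forall p, p \in X -> dist p.1 p.2 = b) ->
  \sum_(p in X) [exists q in Y, q.2 == p.1] <= #|Y|.
Proof.
move=> hX.
have -> : \sum_(p in X) [exists q in Y, q.2 == p.1] = #|[set p in X | [exists q in Y, q.2 == p.1]]|.
  rewrite -sum1_card [RHS]big_mkcond [LHS]big_mkcond; apply: eq_bigr => p _.
  by rewrite inE; case: (p \in X) => //=; case: [exists _, _].
rewrite -(card_in_imset (f := fst)).
  apply: leq_trans (leq_imset_card snd Y); apply/subset_leq_card/subsetP => z.
  case/imsetP => p; rewrite inE => /andP[_ /existsP[q /andP[qY /eqP e]]] ->.
  by apply/imsetP; exists q.
move=> [u v] [w x] /[!inE] /andP[/hX /= h1 _] /andP[/hX /= h2 _] e.
by move: h1; rewrite e -h2 => /dist_injr ->.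
Qed.

Lemma optimal_beta_le_alpha E a b u v w x : optimal E ->
  nonedge E w x -> dist w x = a -> (forall u v, nonedge E u v -> a <= dist u v) ->
  E u v -> dist u v = b -> (forall u v, E u v -> dist u v <= b) -> b <= a.
Proof.
move=> [vE opt optx] wx dwx ha uv duv hb; rewrite leqNgt; apply/negP => ab.
have a0 : 0 < a by rewrite -dwx dist_gt0; case/and3P: wx.
have bn : b < n by rewrite -duv dist_lt.
(* The reverse of a non-edge is a non-edge, and the two lengths sum to [n]. *)
have an : a.*2 <= n.
  have wx' : w != x by case/and3P: wx.
  have := ha x w; rewrite /nonedge eq_sym wx'; case/and3P: wx => _ -> -> /(_ isT).
  by have := dist_sym wx'; lia.
have hdel (p q : 'I_n) : E p q -> dist p q = b -> 
  exists F, [/\ valid F, (forall y z, F y z -> E y z), (forall y z, E y z -> F y z || (dist y z == b)),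
    ~~ F p q & exists2 t, P3t E + (b.-1 + 3 * t) = P3t F + (#|outs E q| + #|ins E p|)
     & #|outs E q| + #|ins E p| <= t + (n - b).-1].
  move=> pq dpq; set S := [set (p, q)].
  have pq' := valid_neq vE pq.
  have hS r : r \in S -> E r.1 r.2 && (dist r.1 r.2 == b) by rewrite inE => /eqP -> /=; rewrite pq dpq eqxx.
  have vF : valid (delp E S) by apply: (@valid_del_longest _ E b S vE hb) => r /hS /andP[_ /eqP].
  have adS : addable (delp E S) S.
    apply: (addable_del_longest vE hb hS) => r1 r2 /[!inE] /eqP -> /eqP -> /=.
    by rewrite eq_sym.
  exists (delp E S); split=> //.
  - by move=> y z /andP[].
  - move=> y z yz; rewrite /delp yz /= inE.
    by case: eqP => [[-> ->]|//]; rewrite dpq eqxx.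
  - by rewrite /delp !inE eqxx andbF.
  have := P3t_addp vF adS; rewrite !big_set1 /=.
  rewrite (@P3t_ext _ _ E); last by apply: addp_delp => r /hS /andP[].
  have oF : outs (delp E S) q = outs E q.
    apply/setP => y; rewrite !inE /delp inE xpair_eqE [q == p]eq_sym (negbTE pq').
    by rewrite andbT.
  have iF : ins (delp E S) p = ins E p.
    apply/setP => y; rewrite !inE /delp inE xpair_eqE (negbTE pq').
    by rewrite !andbF andbT.
  rewrite oF iF dpq => h; exists (tri (delp E S) p q) => //.
  have := tri_lower vF pq'; rewrite oF iF => /(_ _); rewrite -dpq.
  have -> : n - dist p q = dist q p by have := dist_sym pq'; lia.
  by apply; rewrite /delp (negbTE (valid_asym vE pq)).
(* Deletion does not raise the path count, so [b - 1 + 3t <= s], while [s <= t + n - b - 1]. *)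
have bn2 : b.*2 <= n.
  have [F [vF _ _ _ [t h1 h2]]] := hdel _ _ uv duv.
  by have := opt _ vF; lia.
(* Otherwise [zy] would be an edge of length above [n - a], which exceeds [b] because [a < b] and
   [2b <= n]. *)
have short y z : 0 < dist y z < a -> E y z.
  case/andP=> d0 d1; rewrite dist_gt0 in d0; have ds := dist_sym d0.
  apply: contraT => nyz; have := ha y z; rewrite /nonedge d0 nyz /=.
  have [zy _|_ /(_ isT)] := boolP (E z y); last by lia.
  by have := hb _ _ zy; lia.
have better H : valid H -> (forall y z, H y z -> E y z || (dist y z == a)) ->
  (forall y z, E y z -> H y z || (dist y z == b)) ->
  (exists y z, [/\ E y z, dist y z = b & exists y' z', [/\ nonedge E y' z', dist y' z' = a &
     ~~ H y z || H y' z']]) -> P3t H < P3t E.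
  move=> vH h1 h2 h3; rewrite ltn_neqAle opt // andbT; apply/eqP => /(optx _ vH).
  by rewrite leqNgt (xi_lt ab bn2 hb ha h1 h2 h3).
(* Strict loss on deletion gives [b + 3t <= s]; then [t] is eliminated by its lower bound
   [s - (n - b - 1)]. *)
have hX (p q : 'I_n) : E p q -> dist p q = b ->
   2 * (#|outs E q| + #|ins E p|) + 4 * b + 3 <= 3 * n.
  move=> pq dpq; have [F [vF FE EF nF [t h1 h2]]] := hdel _ _ pq dpq.
  suff : P3t F < P3t E by lia.
  apply: (better F vF _ EF) => [y z /FE -> //|].
  by exists p, q; split=> //; exists w, x; rewrite nF.
have omin y : a.-1 <= #|outs E y| by apply: outs_ge => [|z]; [lia|move=> ?; apply: short; lia].
have imin y : a.-1 <= #|ins E y| by apply: ins_ge => [|z]; [lia|move=> ?; apply: short; lia].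
have omax y : #|outs E y| <= b by apply: outs_le => // z; exact: hb.
have imax y : #|ins E y| <= b by apply: ins_le => // z; exact: hb.
(* Strict loss on addition, with [s >= 2(a - 1)], excludes [t = 0]; so [tri_upper] bounds [t] by
   [s - (n - a - 1)]. *)
have hY (p q : 'I_n) : nonedge E p q -> dist p q = a ->
   3 * n <= 4 * a + 2 * (#|outs E q| + #|ins E p|) + 1.
  move=> npq dpq; set S := [set (p, q)].
  have /and3P[pq' npq1 npq2] := npq.
  have adS : addable E S.
    apply: addable1 => // y c; have := c; rewrite cwE => ?; have := c; rewrite cwEl => ?.
    by rewrite !short; lia.
  have vH := valid_addp vE adS.
  have := P3t_addp vE adS; rewrite !big_set1 /= dpq.
  have : P3t (addp E S) < P3t E.
    apply: better => //.
    - by move=> y z; rewrite /addp inE => /orP[-> //|/eqP[-> ->]]; rewrite dpq eqxx orbT.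
    - by move=> y z yz; rewrite /addp yz.
    - by exists u, v; split=> //; exists p, q; split=> //; rewrite /addp !inE eqxx !orbT.
  have := tri_upper vE pq' npq2; have := dist_sym pq'; rewrite dpq.
  have := omin q; have := imin p.
  by case: (tri E p q) => [|t] /=; lia.
have hN1 := hX _ _ uv duv; have hN2 := hY _ _ wx dwx.
(* Inserted in [hN1] and [hN2], these bounds yield [|N| <= 1]. *)
have := omin v; have := imin u; have := omax x; have := imax w => ? ? ? ?.
pose X := [set p | E p.1 p.2 & dist p.1 p.2 == b].
pose Y := [set p | nonedge E p.1 p.2 & dist p.1 p.2 == a].
have XE p : p \in X -> E p.1 p.2 && (dist p.1 p.2 == b) by rewrite inE.
have Xd p : p \in X -> dist p.1 p.2 = b by move/XE/andP => [_ /eqP].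
have Yd p : p \in Y -> dist p.1 p.2 = a by rewrite inE => /andP[_ /eqP].
have vF : valid (delp E X) by exact: (valid_del_longest vE hb Xd).
(* Consecutive longest edges would give [p.2] out-degree at least [b], too large for [hX]. *)
have noXX p q : p \in X -> q \in X -> p.2 != q.1.
  case: p => p1 p2; case: q => q1 q2 /[!inE] /andP[/= p12 /eqP dp] /andP[/= q12 /eqP dq].
  apply/eqP => /= e; have := outs_ge_edge vE q12; rewrite dq -e.
  by have := hX _ _ p12 dp; have := imin p1; lia.
have adX : addable (delp E X) X := addable_del_longest vE hb XE noXX.
(* The incidences of [p] with [Y], summing to [I] over [X]; Booleans suffice since the fixed length
   allows at most one pair of [Y] at each end. *)
pose k p := [exists q in Y, q.1 == p.2] + [exists q in Y, q.2 == p.1].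
have eqX := P3t_addp vF adX.
rewrite (@P3t_ext _ _ E) in eqX; last by apply: addp_delp => r /XE /andP[].
have oF p : p \in X -> outs (delp E X) p.2 = outs E p.2.
  move=> pX; apply/setP => y; rewrite !inE /delp; case: (boolP (_ \in X)) => [/(noXX _ _ pX)|].
    by rewrite eqxx.
  by rewrite andbT.
have iF p : p \in X -> ins (delp E X) p.1 = ins E p.1.
  move=> pX; apply/setP => y; rewrite !inE /delp; case: (boolP (_ \in X)) => [/noXX/(_ pX)|].
    by rewrite eqxx.
  by rewrite andbT.
(* Deleting [p] changes the count by at least [2 - N - 2 * k p]: each of the two degrees is at least
   [a], or [a - 1] when a pair of [Y] meets that end. *)
have costX p : p \in X -> #|outs (delp E X) p.2| + #|ins (delp E X) p.1| + (4 * (a + b) + 2)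
   <= (dist p.1 p.2).-1 + 3 * tri (delp E X) p.1 p.2 + 3 * n + 2 * k p.
  move=> pX; rewrite (Xd _ pX); have /andP[p12 _] := XE _ pX.
  have pn := valid_neq vE p12; have := tri_lower vF pn; rewrite (oF _ pX) (iF _ pX).
  have dp := Xd _ pX.
  have -> : ~~ delp E X p.2 p.1 by rewrite /delp (negbTE (valid_asym vE p12)).
  move=> /(_ isT); have := dist_sym pn; rewrite dp.
  have nonY y z : dist y z = a -> (y, z) \notin Y -> E y z.
    move=> dyz; rewrite inE /nonedge /= dyz eqxx andbT -dist_gt0 dyz a0 /=.
    rewrite negb_and !negbK => /orP[//|zy]; have := hb _ _ zy.
    have yz : y != z by rewrite -dist_gt0 dyz.
    by have := dist_sym yz; lia.
  have ok1 : a <= #|outs E p.2| + [exists q in Y, q.1 == p.2].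
    case: (boolP [exists q in Y, q.1 == p.2]) => [_|/existsPn h]; first by have := omin p.2; lia.
    rewrite addn0; apply: outs_ge => [|y /andP[y0]]; first lia.
    rewrite leq_eqVlt => /orP[/eqP e|l]; last by apply: short; rewrite y0.
    by apply: nonY e _; have := h (p.2, y); rewrite /= eqxx andbT.
  have ok2 : a <= #|ins E p.1| + [exists q in Y, q.2 == p.1].
    case: (boolP [exists q in Y, q.2 == p.1]) => [_|/existsPn h]; first by have := imin p.1; lia.
    rewrite addn0; apply: ins_ge => [|y /andP[y0]]; first lia.
    rewrite leq_eqVlt => /orP[/eqP e|l]; last by apply: short; rewrite y0.
    by apply: nonY e _; have := h (y, p.1); rewrite /= eqxx andbT.
  move: ok1 ok2; rewrite /k; move: (nat_of_bool _) (nat_of_bool _) => k1 k2.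
  by move=> /= *; lia.
(* By [hY] and [N >= -1] the two degrees sum to at least [2b - 1], and neither exceeds [b]. *)
have degY p : p \in Y -> b.-1 <= #|outs E p.2| /\ b.-1 <= #|ins E p.1|.
  rewrite inE => /andP[np /eqP dp]; have := hY _ _ np dp.
  by have := omax p.2; have := imax p.1; move=> /= *; lia.
have noYY p q : p \in Y -> q \in Y -> p.2 != q.1.
  move=> pY; have [+ _] := degY _ pY; case: p q pY => p1 p2 [q1 q2] _ /=.
  rewrite inE /= => h /andP[/and3P[q12 nq _] /eqP dq]; apply/eqP => /= e; rewrite e in h.
  by have := leq_ltn_trans h (outs_lt_nonedge vE q12 nq); rewrite dq; lia.
have adY : addable (delp E X) Y.
  split=> //.
    move=> p; rewrite inE => /andP[/and3P[-> h1 h2] _].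
    by rewrite /delp (negbTE h1) (negbTE h2).
  move=> [p1 p2] y /Yd /= dp c; have := c; rewrite cwE => ?; have := c; rewrite cwEl => ?.
  rewrite /delp !short ?inE /=; [|lia..].
  by apply/andP; split; apply/negP => /andP[_ /eqP]; lia.
have eqY := P3t_addp vF adY.
(* Adding [p] after deleting [X] gains at least [N + 2]: by [degY], both degrees are then exactly
   [b - 1]. *)
have gainY p : p \in Y -> (dist p.1 p.2).-1 + 3 * tri (delp E X) p.1 p.2 + 3 * n + 2 <=
   #|outs (delp E X) p.2| + #|ins (delp E X) p.1| + 4 * (a + b).
  move=> pY; have [h1 h2] := degY _ pY; have := pY; rewrite inE => /andP[/and3P[p12 np1 np2] /eqP dp].
  have := @tri_upper _ (delp E X) p.1 p.2 vF p12; have := dist_sym p12.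
  have -> : ~~ delp E X p.2 p.1 by rewrite /delp (negbTE np2).
  have -> : #|outs (delp E X) p.2| = b.-1.
    apply/eqP; rewrite eqn_leq; apply/andP; split.
      apply: outs_le => // [|y]; first lia.
      rewrite /delp inE /= => /andP[yE]; rewrite yE /=.
      by have := hb _ _ yE; case: eqP => //; lia.
    apply: outs_ge => [|y /andP[y0 y1]]; first lia.
    rewrite /delp inE /=; have -> : E p.2 y.
      apply: contraLR h1 => ny; rewrite -ltnNge.
      by apply: leq_trans (outs_lt_nonedge vE _ ny) y1; rewrite -dist_gt0.
    by rewrite /=; apply: contraTN y1 => /eqP ->; lia.
  have -> : #|ins (delp E X) p.1| = b.-1.
    apply/eqP; rewrite eqn_leq; apply/andP; split.
      apply: ins_le => // [|y]; first lia.
      rewrite /delp inE /= => /andP[yE]; rewrite yE /=.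
      by have := hb _ _ yE; case: eqP => //; lia.
    apply: ins_ge => [|y /andP[y0 y1]]; first lia.
    rewrite /delp inE /=; have -> : E y p.1.
      apply: contraLR h2 => ny; rewrite -ltnNge.
      by apply: leq_trans (ins_lt_nonedge vE _ ny) y1; rewrite -dist_gt0.
    by rewrite /=; apply: contraTN y1 => /eqP ->; lia.
  rewrite dp; case: (tri _ _ _) => [|t] /=; last by move=> dd /(_ isT isT); lia.
  by lia.
pose H := addp (delp E X) Y.
have vH : valid H := valid_addp vF adY.
have : P3t H < P3t E.
  apply: (better _ vH).
  - move=> y z; rewrite /H /addp /delp => /orP[/andP[-> //]|/Yd /= ->].
    by rewrite eqxx orbT.
  - move=> y z yz; rewrite /H /addp /delp yz /= inE /= yz /=.
    by case: (dist y z == b); rewrite ?orbT.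
  - exists u, v; split=> //; exists w, x; split=> //.
    by rewrite /H /addp; apply/orP; right; rewrite inE /= wx dwx eqxx orbT.
rewrite ltnNge => /negP; apply.
have sX : \sum_(p in X) (#|outs (delp E X) p.2| + #|ins (delp E X) p.1|) + #|X| * (4 * (a + b) + 2)
    <= \sum_(p in X) ((dist p.1 p.2).-1 + 3 * tri (delp E X) p.1 p.2) + #|X| * (3 * n) + 2 * \sum_(p in X) k p.
  by rewrite -!sum_nat_const big_distrr -!big_split /=; apply: leq_sum.
have sY : \sum_(p in Y) ((dist p.1 p.2).-1 + 3 * tri (delp E X) p.1 p.2) + #|Y| * (3 * n + 2)
    <= \sum_(p in Y) (#|outs (delp E X) p.2| + #|ins (delp E X) p.1|) + #|Y| * (4 * (a + b)).
  by rewrite -!sum_nat_const -!big_split /=; apply: leq_sum => p pY; rewrite addnA gainY.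
have kY : \sum_(p in X) k p <= 2 * #|Y|.
  by rewrite /k big_split mul2n -addnn; apply: leq_add; [exact: card_ends Xd | exact: card_starts Xd].
have kX : \sum_(p in X) k p <= 2 * #|X|.
  have : \sum_(p in X) k p <= \sum_(p in X) 2.
    by apply: leq_sum => p _; exact: (leq_add (leq_b1 _) (leq_b1 _)).
  by rewrite sum_nat_const; lia.
(* The cases [N = 0, -1, 1]. In each, weighting [I <= 2|Y|] by [(N + 2)/2] and [I <= 2|X|] by
   [(2 - N)/2] bounds [2I] by the total gain. *)
have hN : 4 * (a + b) = 3 * n \/ 4 * (a + b) = (3 * n).+1 \/ (4 * (a + b)).+1 = 3 * n by lia.
move: kX kY eqX eqY sX sY; rewrite -/H; move: (P3t H) (P3t E) (P3t (delp E X)) => pH pE pF.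
move: (\sum_(p in X) _) (\sum_(p in X) _) (\sum_(p in X) _) (\sum_(p in Y) _) (\sum_(p in Y) _) => s1 s2 s3 s4 s5.
move: #|X| #|Y| => nX nY; clear -hN.
case: hN => [-> |[->|<-]]; move: (3 * n) (4 * (a + b)); nia.
Qed.

End Main.

(** * Existence of a non-edge and comparison of the two parameters *)

Lemma dist_exists n (u : 'I_n) k : k < n -> exists v, dist u v = k.
Proof.
move=> kn; have un := ltn_ord u.
have vn : (if u + k < n then u + k else u + k - n) < n by case: ifP; lia.
by exists (Ordinal vn); rewrite distE /=; do !case: ifP; lia.
Qed.

Lemma bigminn_arg (T : finType) (P : pred T) (f : T -> nat) m i0 :
  P i0 -> (forall i, f i <= m) ->
  exists i, [/\ P i, \big[minn/m]_(j | P j) f j = f i & forall j, P j -> f i <= f j].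
Proof.
move=> Pi0 fm; case: (arg_minnP f Pi0) => i Pi imin; exists i; split=> //.
apply/eqP; rewrite eqn_leq; apply/andP; split; last first.
  by elim/big_ind: _ => // x y; rewrite leq_min => -> ->.
have : i \in index_enum T by rewrite mem_index_enum.
elim: (index_enum T) => // j r IH; rewrite inE big_cons => /orP[/eqP <-|/IH h].
  by rewrite Pi geq_minl.
by case: ifP => // _; rewrite geq_min h orbT.
Qed.

(** The path 0, 1, 2 is a witness. It forces an optimal digraph to have an induced two-edge path,
    hence a non-edge. *)
Lemma exists_P3t_gt0 n : 3 <= n -> exists H : rel 'I_n, valid H /\ 0 < P3t H.
Proof.
move=> n3; exists (fun u v => (v == u.+1 :> nat) && (u < 2)); split.
  split.
  - by move=> u; apply/negP => /andP[/eqP]; lia.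
  - by move=> u v _; apply/negP => /andP[/andP[/eqP ? _] /andP[/eqP ? _]]; lia.
  - move=> u v w; rewrite cwE => h /andP[/eqP wu _].
    by move: h; rewrite !distE; have := ltn_ord w; do !case: ifP => ?; lia.
have h0 : 0 < n by lia. 
have h1 : 1 < n by lia.
rewrite card_gt0; apply/set0Pn.
by exists (Ordinal h0, Ordinal h1, Ordinal n3); rewrite inE.
Qed.

Theorem mainTheorem14 (n : nat) (hn : 4 <= n) (E : rel 'I_n) :
  optimal E ->
  exists a : nat, alphaG E = Some a /\ betaG E <= a /\ (a = betaG E \/ a = (betaG E).+1).
Proof.
move=> oE; case: (oE) => vE opt _.
have /existsP[p0 p0E] : [exists p : 'I_n * 'I_n, nonedge E p.1 p.2].
  have [H [vH H0]] := @exists_P3t_gt0 n (ltnW hn).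
  have := leq_trans H0 (opt _ vH); rewrite card_gt0 => /set0Pn[[[u v] w]].
  rewrite inE /= => /and5P[_ _ uw _ /and3P[_ nuw nwu]].
  by apply/existsP; exists (u, w); rewrite /nonedge uw nuw.
rewrite /alphaG; case: ifP => [_|/existsP[]]; last by exists p0.
have [||p [pE -> pmin]] := @bigminn_arg _ (fun p : 'I_n * 'I_n => nonedge E p.1 p.2)
  (fun p => dist p.1 p.2) n p0 => //; first by move=> i; exact/ltnW/dist_lt.
exists (dist p.1 p.2); split=> //.
have bmax u v : E u v -> dist u v <= betaG E.
  by move=> uv; exact: (@leq_bigmax_cond _ (fun p => E p.1 p.2) (fun p => dist p.1 p.2) (u, v)).
have ba : betaG E <= dist p.1 p.2.
  have [q qE|none] := pickP (fun p : 'I_n * 'I_n => E p.1 p.2); last first.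
    by rewrite /betaG big_pred0.
  have q0 : 0 < #|[pred r : 'I_n * 'I_n | E r.1 r.2]| by apply/card_gt0P; exists q.
  have [r rE e] := eq_bigmax_cond (fun r => dist r.1 r.2) q0.
  exact: (optimal_beta_le_alpha oE pE erefl (fun u v h => pmin (u, v) h) rE (esym e) bmax).
split=> //; suff : dist p.1 p.2 <= (betaG E).+1 by lia.
(* If alpha exceeds beta + 1, take [y] at distance beta + 1 from [p.1]. Since twice alpha is at most
   [n], both orders of this pair are longer than beta, so it is a non-edge shorter than alpha. *)
rewrite leqNgt; apply/negP => lt.
have /and3P[pp np1 np2] := pE.
have := pmin (p.2, p.1); rewrite /= /nonedge eq_sym pp np1 np2 => /(_ isT) le.
have sp := dist_sym pp.
have [y dy] := @dist_exists _ p.1 (betaG E).+1 (ltn_trans lt (dist_lt _ _)).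
have yn : p.1 != y by rewrite -dist_gt0 dy.
have := pmin (p.1, y); rewrite /= /nonedge yn dy.
have -> : ~~ E p.1 y by apply/negP => /bmax; rewrite dy ltnn.
have -> : ~~ E y p.1.
  by apply/negP => /bmax; have := dist_sym yn; rewrite dy; move: lt le sp => /=; lia.
by move=> /(_ isT); rewrite leqNgt lt.
Qed.
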